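(* Let $k,n$ be integers with $k\ge1$, $n\ge2$, let $F$ be an oriented tree of order $n$, and let $D$ be a $k$-extension of $F$. Then $\mathrm{unv}(D)\le 3^{\binom{2k+2}{2}}\cdot \mathrm{unv}^*(F)$.
   Context: A digraph is $p$-unavoidable if it is contained in (isomorphic to a subdigraph of) every tournament of order $p$; for an acyclic digraph $D$, $\mathrm{unv}(D)$ is the least such $p$. For an acyclic digraph $D$, $\mathrm{unv}^*(D)$ is the maximum of $\mathrm{unv}(H)+|V(D)\setminus V(H)|$ over all subdigraphs $H$ of $D$. An oriented tree is an orientation of a tree. For an acyclic digraph $A$ and positive integer $k$, an acyclic digraph $D$ is a $k$-extension of $A$ if there is a set $S$ of $k$ vertices of $D$ with $D-S=A$. *)

(* Defs.v *)
From mathcomp Require Import all_boot.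
From mathcomp Require Import boolp.

Set Implicit Arguments.
Unset Strict Implicit.
Unset Printing Implicit Defensive.

Record digraph := Digraph { vertex :> finType; arc : rel vertex }.

(* [cycle] counts a loop as a cycle of length 1 and a pair of opposite arcs as
   a cycle of length 2, so an acyclic digraph has neither. *)
Definition acyclic (D : digraph) : Prop :=
  forall c : seq D, ucycle (@arc D) c -> c = [::].

Record dag := Dag { dag_digraph :> digraph; dag_acyclic : acyclic dag_digraph }.

Definition tournament (T : digraph) : Prop :=
  irreflexive (@arc T) /\
  (forall x y : T, x != y -> arc x y (+) arc y x).

Definition contained (D T : digraph) : Prop :=
  exists f : D -> T, injective f /\ {homo f : x y / arc x y}.

Definition isomorphic (D1 D2 : digraph) : Prop :=
  exists f : D1 -> D2, bijective f /\ {mono f : x y / arc x y}.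

Definition unavoidable (D : digraph) (p : nat) : Prop :=
  forall T : digraph, tournament T -> #|T| = p -> contained D T.

Lemma acyclic_back (D : digraph) (x y : D) :
  acyclic D -> connect (@arc D) x y -> ~~ arc y x.
Proof.
move=> aD /connectP[p xp ->]; apply/negP; case/shortenP: xp => q xq uq _ aqx.
have : ucycle (@arc D) (x :: q) by rewrite /ucycle /= rcons_path xq aqx.
by move/aD.
Qed.

Lemma acyclic_source (D : digraph) (S : {set D}) (x0 : D) :
    acyclic D -> x0 \in S ->
  exists2 x, x \in S & forall y, y \in S -> ~~ arc y x.
Proof.
move=> aD Sx0.
pose anc x := [set z | connect (@arc D) z x].
case: (arg_minnP (fun x => #|anc x|) Sx0) => x Sx minx; exists x => // y Sy.
apply/negP => ayx; have := minx y Sy; rewrite leqNgt => /negP[].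
apply/proper_card/properP; split.
  by apply/subsetP => z; rewrite !inE => /connect_trans -> //; apply: connect1.
by exists x; rewrite !inE //; apply/negP => /(acyclic_back aD); rewrite ayx.
Qed.

Lemma acyclic_sink (D : digraph) (S : {set D}) (x0 : D) :
    acyclic D -> x0 \in S ->
  exists2 x, x \in S & forall y, y \in S -> ~~ arc x y.
Proof.
move=> aD Sx0.
pose des x := [set z | connect (@arc D) x z].
case: (arg_minnP (fun x => #|des x|) Sx0) => x Sx minx; exists x => // y Sy.
apply/negP => axy; have := minx y Sy; rewrite leqNgt => /negP[].
apply/proper_card/properP; split.
  by apply/subsetP => z; rewrite !inE; apply: connect_trans; apply: connect1.
by exists x; rewrite !inE //; apply/negP => /(acyclic_back aD); rewrite axy.
Qed.

Lemma embed_in_tournament (D T : digraph) :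
    acyclic D -> tournament T ->
  forall (m : nat) (S : {set D}) (U : {set T}), #|S| = m -> 2 ^ m <= #|U| ->
  exists f : D -> T, [/\ {in S &, injective f}, {in S, forall x, f x \in U}
    & {in S &, {homo f : x y / arc x y}}].
Proof.
move=> aD [irrT totT]; elim=> [|m IHm] S U cS cU.
  have /card_gt0P[v Uv] : 0 < #|U| by apply: leq_trans cU.
  by exists (fun=> v); rewrite (cards0_eq cS); split=> x; rewrite inE.
have /card_gt0P[v Uv] : 0 < #|U| by apply: leq_trans cU; rewrite expn_gt0.
have /card_gt0P[x0 Sx0] : 0 < #|S| by rewrite cS.
have extend x (N : {set T}) (d : rel D) (t : rel T) :
    x \in S -> N \subset U -> v \notin N -> 2 ^ m <= #|N| ->
    (forall y, y \in S -> arc x y -> forall w, w \in N -> arc v w) ->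
    (forall y, y \in S -> arc y x -> forall w, w \in N -> arc w v) ->
  exists f : D -> T, [/\ {in S &, injective f}, {in S, forall x, f x \in U}
    & {in S &, {homo f : x y / arc x y}}].
  move=> Sx sNU vN cN outx inx.
  have cSx : #|S :\ x| = m by move: cS; rewrite (cardsD1 x) Sx => -[].
  have [f [injf fN homf]] := IHm _ _ cSx cN.
  have xx : ~~ arc x x by apply: (acyclic_back aD); apply: connect0.
  have fN' y : y \in S -> y != x -> f y \in N.
    by move=> Sy yx; apply: fN; rewrite !inE yx.
  exists (fun y => if y == x then v else f y); split.
  - move=> y z Sy Sz; case: eqVneq => [->|yx]; case: eqVneq => [->|zx] // e.
    + by have := fN' z Sz zx; rewrite -e (negPf vN).
    + by have := fN' y Sy yx; rewrite e (negPf vN).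
    + by apply: injf; rewrite ?inE ?yx ?zx.
  - by move=> y Sy; case: eqVneq => // yx; apply: (subsetP sNU); apply: fN'.
  - move=> y z Sy Sz; case: eqVneq => [->|yx]; case: eqVneq => [->|zx] a.
    + by rewrite a in xx.
    + by apply: (outx z) => //; apply: fN'.
    + by apply: (inx y) => //; apply: fN'.
    + by apply: homf; rewrite ?inE ?yx ?zx.
pose No := [set w in U | arc v w]; pose Ni := [set w in U | arc w v].
have sNo : No \subset U by apply/subsetP => w; rewrite inE => /andP[].
have sNi : Ni \subset U by apply/subsetP => w; rewrite inE => /andP[].
have vNo : v \notin No by rewrite inE irrT andbF.
have vNi : v \notin Ni by rewrite inE irrT andbF.
have cN : 2 ^ m <= #|No| \/ 2 ^ m <= #|Ni|.
  have : #|U| <= (#|No| + #|Ni|).+1.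
    rewrite (cardsD1 v) Uv add1n ltnS.
    apply: leq_trans (leq_card_setU No Ni); apply/subset_leq_card/subsetP => w.
    rewrite !inE => /andP[wv Uw]; rewrite Uw /=.
    by have := totT w v wv; case: (arc w v); case: (arc v w).
  move=> /(leq_trans cU); rewrite expnS mul2n -addnn.
  case: (leqP (2 ^ m) #|No|) => [|lo]; first by left.
  case: (leqP (2 ^ m) #|Ni|) => [|li]; first by right.
  have := leq_add lo li; rewrite addSn addnS => h /(leq_trans h).
  by rewrite ltnn.
case: cN => cN.
  have [x Sx srcx] := acyclic_source aD Sx0.
  apply: (extend x No (@arc D) (@arc T)) => // y Sy a w.
    by rewrite inE => /andP[].
  by move: (srcx y Sy); rewrite a.
have [x Sx snkx] := acyclic_sink aD Sx0.
apply: (extend x Ni (@arc D) (@arc T)) => // y Sy a w.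
  by move: (snkx y Sy); rewrite a.
by rewrite inE => /andP[].
Qed.

Lemma unavoidable_ex (D : dag) : exists p, `[< unavoidable D p >].
Proof.
exists (2 ^ #|D|); apply/asboolP => T tT cT.
have [||f [injf _ homf]] := @embed_in_tournament D T (@dag_acyclic D) tT
  #|D| [set: D] [set: T].
- by rewrite cardsT.
- by rewrite cardsT cT.
by exists f; split=> [x y|x y]; [apply: injf | apply: homf]; rewrite inE.
Qed.

Definition unv (D : dag) : nat := ex_minn (unavoidable_ex D).

(* The subdigraph with vertex set S whose arcs are the arcs of D that lie in A
   and have both ends in S; every subdigraph of D is obtained in this way. *)
Definition subdigraph (D : digraph) (S : {set D}) (A : {set D * D}) : digraph :=
  @Digraph {x : D | x \in S}
    (fun x y => arc (val x) (val y) && ((val x, val y) \in A)).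

Lemma subdigraph_acyclic (D : dag) (S : {set D}) (A : {set D * D}) :
  acyclic (subdigraph S A).
Proof.
move=> c /andP[cc uc].
have /dag_acyclic : ucycle (@arc D) (map val c).
  rewrite /ucycle (map_inj_uniq val_inj) uc andbT.
  by apply: (homo_cycle (e := @arc (subdigraph S A))) cc => x y /andP[].
by case: c {cc uc}.
Qed.

Definition subdag (D : dag) (S : {set D}) (A : {set D * D}) : dag :=
  Dag (@subdigraph_acyclic D S A).

Definition unv_star (D : dag) : nat :=
  \max_(S : {set D}) \max_(A : {set D * D}) (unv (subdag S A) + #|~: S|).

Definition delete (D : digraph) (S : {set D}) : digraph :=
  subdigraph (~: S) [set: D * D].

Definition is_tree (V : finType) (E : rel V) : Prop :=
  [/\ symmetric E, irreflexive E, 0 < #|V|,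
      forall x y : V, connect E x y
    & forall c : seq V, ucycle E c -> size c <= 2].

Definition orientation (D : digraph) (E : rel D) : Prop :=
  forall x y : D, (E x y -> arc x y (+) arc y x) /\ (arc x y -> E x y).

Definition oriented_tree (D : digraph) : Prop :=
  exists E : rel D, is_tree E /\ orientation E.

(* D - S = A is read up to isomorphism. *)
Definition k_extension (k : nat) (A D : dag) : Prop :=
  exists S : {set D}, #|S| = k /\ isomorphic (delete S) A.

(* Main.v *)
From mathcomp Require Import all_boot boolp zify.
Require Import Defs.

Set Implicit Arguments.
Unset Strict Implicit.
Unset Printing Implicit Defensive.

(* Let m = unv_star F, r = 2k+1, N = 3 ^ 'C(r+1, 2) * m, and let T be a tournament
   of order N.  In a set of size 3K at least K vertices have K out-neighbours
   inside the set, so T contains at least 3 ^ 'C(r, 2) * (N / 3 ^ r) ^ r = m N^(2k)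
   transitive r-tuples.  Fixing the best choice t_0, ..., t_(k-1) for the odd
   positions leaves at least m N^k transitive (k+1)-tuples on the even positions;
   discarding vertices that lie in few of them yields disjoint sets A_0, ..., A_k,
   the j-th lying between t_(j-1) and t_j, such that for i < j each vertex of A_i
   has at least m out-neighbours in A_j and each vertex of A_j has at least m
   in-neighbours in A_i.  The added vertices S of D, taken in a topological order,
   go to the t_i, and a vertex of F preceded by exactly i of them must go to A_i.
   The forest induced by a level splits into components C, each joined to the
   part W already embedded by a single arc, so C has to avoid at most |F \ C|
   vertices of a neighbourhood of size m >= unv(C) + |F \ C|. *)

(** * Counting transitive tuples in a tournament *)

Definition outN (T : digraph) (U : {set T}) (v : T) := [set w in U | arc v w].

Definition inN (T : digraph) (U : {set T}) (v : T) := [set w in U | arc w v].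

(** The out-degrees inside [X] average [(#|X| - 1) / 2], which is at least [K]. *)
Lemma big_outdegree (T : digraph) (X : {set T}) (K : nat) :
  tournament T -> 2 * K < #|X| -> exists2 v, v \in X & K <= #|outN X v|.
Proof.
move=> [irrT totT] cX; apply/exists_inP; apply: contraLR cX.
rewrite negb_exists_in -leqNgt => /forall_inP outX.
have outE v : #|outN X v| = \sum_(w in X) arc v w.
  by rewrite -sum1_card big_mkcond [RHS]big_mkcond /=; apply: eq_bigr => w _;
    rewrite inE; case: (w \in X); case: (arc v w).
have lt_out : \sum_(v in X) (\sum_(w in X) arc v w).+1 <= #|X| * K.
  by rewrite -sum_nat_const; apply: leq_sum => v /outX; rewrite -ltnNge outE.
have sumE : 2 * \sum_(v in X) \sum_(w in X) arc v w = #|X| * #|X|.-1.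
  rewrite mul2n -addnn {2}exchange_big -big_split /= -sum_nat_const.
  apply: eq_bigr => v Xv; rewrite -big_split /= (cardsD1 v) Xv add1n /=.
  rewrite (bigD1 v) //= irrT add0n -sum1_card big_mkcond [RHS]big_mkcond /=.
  apply: eq_bigr => w _; rewrite !inE andbC; case: (eqVneq w v) => //= wv.
  by case: (w \in X) => //; have := totT w v wv; case: (arc w v); case: (arc v w).
have: \sum_(v in X) (\sum_(w in X) arc v w).+1
    = #|X| + \sum_(v in X) \sum_(w in X) arc v w.
  by rewrite -[X in X + _]sum1_card -big_split.
nia.
Qed.

(** If fewer than [K] vertices qualified, the more than [2 * K] others would include one with [K]
    out-neighbours among themselves. *)
Lemma many_big_outdegree (T : digraph) (U : {set T}) (K : nat) :
  tournament T -> 3 * K <= #|U| -> K <= #|[set v in U | K <= #|outN U v|]|.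
Proof.
move=> tT cU; set G := [set v in U | _]; rewrite leqNgt; apply/negP => ltG.
have := cardsID G U; have -> : U :&: G = G.
  by apply/setP => v; rewrite !inE andbA andbb.
move=> cD; have [|v] := @big_outdegree T (U :\: G) K tT; first by lia.
rewrite !inE => /andP[/nandP[/negP//|/negP nv] Uv] le_v; apply: nv.
apply: leq_trans le_v _; apply/subset_leq_card/subsetP => w.
by rewrite !inE => /andP[/andP[_ ->]].
Qed.

Definition transitive_tuples (T : digraph) (r : nat) (U : {set T}) :=
  [set t : r.-tuple T | pairwise (@arc T) t && all [in U] t].

Lemma many_transitive_tuples (T : digraph) (r M : nat) (U : {set T}) :
    tournament T -> 3 ^ r * M <= #|U| ->
  3 ^ 'C(r, 2) * M ^ r <= #|transitive_tuples r U|.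
Proof.
move=> tT; elim: r U => [|r IHr] U cU.
  rewrite bin0n !expn0 mul1n card_gt0; apply/set0Pn; exists [tuple].
  by rewrite inE.
pose G := [set v in U | 3 ^ r * M <= #|outN U v|].
have cG : 3 ^ r * M <= #|G|.
  by apply: many_big_outdegree => //; rewrite mulnA -expnS.
(* The factor [3 ^ r * M] counts first entries; the other factor is the induction hypothesis inside
   the out-neighbourhood of that entry. *)
have -> : 3 ^ 'C(r.+1, 2) * M ^ r.+1 = (3 ^ r * M) * (3 ^ 'C(r, 2) * M ^ r).
  by rewrite binS bin1 expnD expnS; lia.
rewrite -[#|transitive_tuples _ _|]sum1_card.
rewrite (partition_big (@thead r T) predT) //=.
apply: leq_trans (leq_mul cG (leqnn _)) _; rewrite -sum_nat_const.
rewrite [X in _ <= X](bigID [in G]) /=.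
apply: leq_trans (leq_addr _ _); apply: leq_sum => v; rewrite inE => /andP[Uv outv].
apply: leq_trans (IHr _ outv) _.
have inj_cons : injective (@cons_tuple r T v).
  by move=> s t /(congr1 val) [] /val_inj.
rewrite -(card_imset _ inj_cons) sum1dep_card.
apply/subset_leq_card/subsetP => _ /imsetP[t + ->].
rewrite !inE theadE eqxx andbT /= Uv /= => /andP[-> allt]; rewrite andbT.
by apply/andP; split; apply: sub_all allt => w; rewrite !inE => /andP[].
Qed.

(** * Extracting a subfamily without sparse vertices *)

Lemma card_ffun_2fixed (I V : finType) (i j : I) (x : V) (Y : {set V})
    (Q : {set {ffun I -> V}}) :
    i != j -> {in Q, forall g : {ffun I -> V}, g i = x /\ g j \in Y} ->
  #|Q| <= #|Y| * #|V| ^ (#|I| - 2).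
Proof.
move=> ij QP.
pose F (l : I) : pred V := [pred w | if l == i then w == x else (l == j) ==> (w \in Y)].
have : #|Q| <= #|(family F : simpl_pred {ffun I -> V})|.
  apply/subset_leq_card/subsetP => g /QP[gi gj]; apply/familyP => l.
  rewrite /F; case: (eqVneq l i) => [->|_]; first by rewrite inE gi.
  by case: (eqVneq l j) => [->|].
move/leq_trans; apply.
rewrite card_family foldrE big_map big_enum /=.
rewrite (bigD1 i) //= /F eqxx card1 mul1n (bigD1 j) 1?eq_sym //=.
rewrite (negPf ij) eqxx leq_mul //.
rewrite (eq_bigr (fun _ => #|V|)) => [|l /andP[/negPf-> /negPf->]]; last first.
  exact: eq_card.
rewrite prod_nat_const leq_eqVlt; apply/orP; left; apply/eqP; congr (_ ^ _).
rewrite -[#|I|](cardC (pred2 i j)) card2 ij addKn.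
by apply: eq_card => l; rewrite !inE negb_or.
Qed.

(* Among the families still carrying more than [m - 1] members per
   [#|V| ^ (#|I| - 2)] and per vertex, take a smallest one: a vertex violating
   the conclusion could be deleted together with the members through it. *)
Lemma dense_subfamily (I V : finType) (m : nat) (Q : {set {ffun I -> V}}) :
    {in Q &, forall (g g' : {ffun I -> V}) i j, g i = g' j -> i = j} -> 2 <= #|I| ->
    m.-1 * #|V| ^ (#|I| - 1) < #|Q| ->
  exists2 Q' : {set {ffun I -> V}}, Q' \subset Q /\ Q' != set0 &
    forall (g : {ffun I -> V}) i j, g \in Q' -> i != j ->
      m <= #|[set (g' : {ffun I -> V}) j | g' in [set g' in Q' | g' i == g i]]|.
Proof.
move=> disjQ I2 cQ.
pose W (R : {set {ffun I -> V}}) := [set x | [exists g in R, exists i, g i == x]].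
pose ok (R : {set {ffun I -> V}}) :=
  (R \subset Q) && (m.-1 * #|V| ^ (#|I| - 2) * #|W R| < #|R|).
(* The exponent [#|I| - 1] exceeds [#|I| - 2] by one, and the extra factor [#|V|] bounds
   [#|W Q|]. *)
have okQ : ok Q.
  rewrite /ok subxx /=; apply: leq_ltn_trans cQ.
  have -> : #|I| - 1 = (#|I| - 2).+1 by lia.
  by rewrite -mulnA expnSr !leq_mul // max_card.
case: (arg_minnP (fun R : {set {ffun I -> V}} => #|R|) okQ) => R /andP[sRQ cR] minR.
exists R.
  by split=> //; apply: contraL cR => /eqP->; rewrite cards0 ltn0.
move=> g i j Rg ij; set B := [set (_ : {ffun I -> V}) j | _ in _].
rewrite leqNgt; apply/negP => cB.
pose R' := [set g' in R | g' i == g i].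
(* Members through [g i] take their [j]-th value in [B], which has at most [m.-1] elements. *)
have cR' : #|R'| <= m.-1 * #|V| ^ (#|I| - 2).
  apply: leq_trans (@card_ffun_2fixed I V i j (g i) B R' ij _) _; last first.
    by rewrite leq_mul //; lia.
  move=> g' R'g'; split; first by move: R'g'; rewrite inE => /andP[_ /eqP].
  by apply/imsetP; exists g'.
have sR'R : R' \subset R by apply/subsetP => g'; rewrite inE => /andP[].
have cD : #|R :\: R'| + #|R'| = #|R| by rewrite -(cardsID R' R) (setIidPr sR'R) addnC.
(* The vertex [g i] disappears: by [disjQ] it occurs only at coordinate [i], and the members having
   it there form [R']. *)
have cW : #|W (R :\: R')|.+1 <= #|W R|.
  apply/proper_card/properP; split.
    apply/subsetP => x; rewrite !inE => /exists_inP[g']; rewrite !inE => /andP[_ Rg'] h.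
    by apply/exists_inP; exists g'.
  exists (g i); rewrite inE.
    by apply/exists_inP; exists g => //; apply/existsP; exists i.
  apply/exists_inP => -[g']; rewrite !inE => /andP[+ Rg'] /existsP[l /eqP gl].
  have il := disjQ _ _ (subsetP sRQ _ Rg') (subsetP sRQ _ Rg) _ _ gl.
  by rewrite il in gl; rewrite Rg' gl eqxx.
have R'0 : 0 < #|R'| by rewrite card_gt0; apply/set0Pn; exists g; rewrite inE Rg /=.
have /minR : ok (R :\: R').
  rewrite /ok (subset_trans (subsetDl _ _) sRQ) /=.
  have := leq_mul (leqnn (m.-1 * #|V| ^ (#|I| - 2))) cW.
  rewrite mulnS => le_a; rewrite -(ltn_add2r #|R'|) cD; apply: leq_ltn_trans cR.
  by apply: leq_trans le_a; rewrite addnC leq_add2r.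
by rewrite -cD -[X in _ <= X]addn0 leq_add2l leqNgt R'0.
Qed.

(** * Unavoidability inside a vertex set *)

Lemma unv_unavoidable (D : dag) : unavoidable D (unv D).
Proof. by rewrite /unv; case: ex_minnP => p /asboolP. Qed.

Lemma unv_leq (D : dag) (p : nat) : unavoidable D p -> unv D <= p.
Proof. by move=> uD; rewrite /unv; case: ex_minnP => q _; apply; apply/asboolP. Qed.

Lemma unv_star_geq (F : dag) (C : {set F}) :
  unv (subdag C [set: F * F]) + #|~: C| <= unv_star F.
Proof.
apply: leq_trans (leq_bigmax_cond C _) => //.
exact: (leq_bigmax_cond (F := fun A => unv (subdag C A) + #|~: C|)).
Qed.

Lemma embed_induced (F : dag) (T : digraph) (C : {set F}) (U : {set T}) (x0 : T) :
    tournament T -> unv (subdag C [set: F * F]) <= #|U| ->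
  exists f : F -> T, [/\ {in C &, injective f}, {in C, forall x, f x \in U}
    & {in C &, {homo f : x y / arc x y}}].
Proof.
(* Unavoidability concerns tournaments of one exact order, so [U] is cut down to a list [s] of that
   length; [x0] is only the value outside [C]. *)
move=> [irrT totT] /card_geqP[s [us cs sU]].
pose TU := @Digraph {x : T | x \in s} (fun x y => arc (val x) (val y)).
have tTU : tournament TU.
  by split=> [x|x y xy]; [apply: irrT | apply: totT].
have cTU : #|TU| = unv (subdag C [set: F * F]).
  by rewrite card_sig -cs -(card_uniqP us).
have [f [injf homf]] := unv_unavoidable tTU cTU.
exists (fun x => if insub x is Some y then val (f y) else x0).
have inC x (Cx : x \in C) : insub x = Some (Sub x Cx : {x | x \in C}) by apply: insubT.
split=> [x y Cx Cy|x Cx|x y Cx Cy]; rewrite !inC.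
- by move=> /val_inj /injf /(congr1 val).
- exact/sU/(valP (f _)).
- by move=> axy; apply: (homf (Sub x Cx) (Sub y Cy)); rewrite /= axy inE.
Qed.

(** * Connected vertex sets in a tree *)

Definition restrict (V : finType) (E : rel V) (W : {set V}) : rel V :=
  [rel x y | [&& E x y, x \in W & y \in W]].

Definition connected_in (V : finType) (E : rel V) (W : {set V}) :=
  {in W &, forall x y, connect (restrict E W) x y}.

Lemma connect_restrictP (V : finType) (E : rel V) (W : {set V}) (x y : V) :
    x \in W -> connect (restrict E W) x y ->
  exists p, [/\ path E x p, uniq (x :: p), all [in W] (x :: p) & last x p = y].
Proof.
move=> Wx /connectP[p xp ->]; case/shortenP: xp => q xq uq _.
exists q; split=> //; first by apply: sub_path xq => a b /and3P[].
rewrite /= Wx /=; elim: q {uq} x Wx xq => //= z q IHq x Wx /andP[/and3P[_ _ Wz] zq].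
by rewrite Wz (IHq z).
Qed.

Lemma connected_in_setU (V : finType) (E : rel V) (W C : {set V}) (u v : V) :
    symmetric E -> connected_in E W -> connected_in E C ->
    u \in W -> v \in C -> E u v ->
  connected_in E (W :|: C).
Proof.
move=> symE cW cC Wu Cv Euv.
have symR : connect_sym (restrict E (W :|: C)).
  apply: sym_connect_sym; apply: symmetric_from_pre => x y /and3P[Exy Wx Wy].
  by apply/and3P; split=> //; rewrite symE.
have toU x : x \in W :|: C -> connect (restrict E (W :|: C)) u x.
  have sub (S : {set V}) : S \subset W :|: C ->
    subrel (connect (restrict E S)) (connect (restrict E (W :|: C))).
    move=> sS; apply: connect_sub => a b /and3P[Eab Sa Sb]; apply: connect1.
    by apply/and3P; split=> //; apply: (subsetP sS).
  rewrite inE => /orP[Wx|Cx]; first by apply: (sub W (subsetUl _ _)); apply: cW.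
  apply: (connect_trans (y := v)); last by apply: (sub C (subsetUr _ _)); apply: cC.
  by apply/connect1/and3P; split; rewrite // inE ?Wu ?Cv ?orbT.
move=> x y /toU ux /toU uy; apply: connect_trans uy.
by rewrite symR.
Qed.

(** Two such edges, closed up by a simple path in [W] and one in [C], form a cycle; having at most 2
    vertices, it leaves both paths trivial. *)
Lemma tree_one_edge (V : finType) (E : rel V) (W C : {set V}) (u u' v v' : V) :
    is_tree E -> connected_in E W -> connected_in E C -> [disjoint W & C] ->
    u \in W -> u' \in W -> v \in C -> v' \in C -> E u v -> E u' v' ->
  u = u' /\ v = v'.
Proof.
move=> [symE _ _ _ cycE] cW cC dWC Wu Wu' Cv Cv' Euv Eu'v'.
have [p [up uniqp Wp lastp]] := connect_restrictP Wu (cW _ _ Wu Wu').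
have [q [vq uniqq Cq lastq]] := connect_restrictP Cv' (cC _ _ Cv' Cv).
have : ucycle E ((u :: p) ++ v' :: q).
  apply/andP; split.
    by rewrite /= rcons_path cat_path /= last_cat /= up lastp Eu'v' vq lastq symE.
  rewrite cat_uniq uniqp uniqq andbT; apply/hasPn => z /(allP Cq) Cz.
  by apply: contraL Cz => /(allP Wp) Wz; rewrite (disjointFr dWC Wz).
move=> /cycE; rewrite size_cat /= => sz.
case: p lastp sz {up uniqp Wp} => [/= ->|]; last by move=> ? ? _ /=; lia.
by case: q lastq {vq uniqq Cq} => [/= ->|] // ? ? _ /=; lia.
Qed.

(** * Embedding an oriented tree level by level *)

(** Levels never decrease along arcs, so the single edge joining a new component to the embedded
    part points to the higher level. This decides between an out- and an in-neighbourhood. *)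
Lemma embed_leveled_tree (F : dag) (T : digraph) (K : nat) (lev : F -> 'I_K)
    (A : 'I_K -> {set T}) :
    oriented_tree F -> tournament T ->
    (forall x y : F, arc x y -> lev x <= lev y) ->
    (forall i, unv_star F <= #|A i|) ->
    (forall (i j : 'I_K) x, i < j -> x \in A i -> unv_star F <= #|outN (A j) x|) ->
    (forall (i j : 'I_K) x, j < i -> x \in A i -> unv_star F <= #|inN (A j) x|) ->
  exists f : F -> T, [/\ injective f, forall x, f x \in A (lev x)
    & {homo f : x y / arc x y}].
Proof.
move=> [E [treeE oriE]] tT levF bigA outA inA.
have [symE irrE /card_gt0P[v0 _] conE _] := treeE.
pose EL := [rel x y | E x y && (lev x == lev y)].
have symEL : connect_sym EL.
  by apply: sym_connect_sym => x y; rewrite /= symE eq_sym.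
have EL_lev x y : connect EL x y -> lev y = lev x.
  move=> /connectP[p xp ->]; elim: p x xp => //= z p IHp x /andP[/andP[_ /eqP->]].
  exact: IHp.
(* Closure of [W] under [EL] ensures that every edge leaving [W] changes level. *)
pose good (W : {set F}) (f : F -> T) := [/\ connected_in E W,
  forall x y, x \in W -> EL x y -> y \in W, {in W &, injective f},
  {in W, forall x, f x \in A (lev x)} & {in W &, {homo f : x y / arc x y}}].
pose Cp v := [set x | connect EL v x].
have EC v : connected_in E (Cp v).
  move=> x y; rewrite !inE => vx vy.
  have /connectP[p xp ->] : connect EL x y by apply: connect_trans vy; rewrite symEL.
  elim: p x vx xp {y vy} => //= z p IHp x vx /andP[xz zp].
  have vz : connect EL v z := connect_trans vx (connect1 (e := EL) xz).
  apply: connect_trans (IHp _ vz zp); apply: connect1.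
  by case/andP: xz => Exz _; apply/and3P; rewrite !inE.
have extend (W : {set F}) f v (U : {set T}) : good W f -> v \notin W ->
    connected_in E (W :|: Cp v) ->
    U \subset A (lev v) -> unv_star F <= #|U| ->
    (forall x y, x \in W -> y \in Cp v -> arc x y -> forall w, w \in U -> arc (f x) w) ->
    (forall x y, x \in W -> y \in Cp v -> arc y x -> forall w, w \in U -> arc w (f x)) ->
  exists f', good (W :|: Cp v) f'.
  move=> [cW clW injf fA homf] vW cWC sUA cU outW inW.
  have WC x : x \in W -> x \notin Cp v.
    move=> Wx; apply: contra vW; rewrite inE symEL => /connectP[p xp ->].
    elim: p x Wx xp => //= z p IHp x Wx /andP[/(clW _ _ Wx)]; exact: IHp.
  (* At most [#|W| <= #|~: Cp v|] vertices of [U] are already taken, a loss that [unv_star F]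
     absorbs. *)
  have cCU : unv (subdag (Cp v) [set: F * F]) <= #|U :\: f @: W|.
    have cW' : #|W| <= #|~: Cp v|.
      by apply/subset_leq_card/subsetP => x; rewrite inE; apply: WC.
    have cI : #|U :&: f @: W| <= #|~: Cp v|.
      apply: leq_trans cW'; apply: leq_trans (leq_imset_card f _).
      exact/subset_leq_card/subsetIr.
    rewrite -(leq_add2l #|U :&: f @: W|) cardsID addnC; apply: leq_trans cU.
    by apply: leq_trans (unv_star_geq (Cp v)); rewrite leq_add2l.
  have [g [injg gU homg]] := embed_induced (f v) tT cCU.
  have gU' x : x \in Cp v -> g x \in U by move=> /gU /setDP[].
  have gW x y : x \in Cp v -> y \in W -> g x != f y.
    move=> /gU /setDP[_ gx] Wy; apply: contraNneq gx => ->; exact: imset_f.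
  exists (fun x => if x \in Cp v then g x else f x); split=> //.
  - move=> x y; rewrite !in_setU => /orP[Wx|Cx] exy.
      by rewrite (clW _ _ Wx exy).
    apply/orP; right; move: Cx; rewrite !inE => vx.
    exact: connect_trans vx (connect1 (e := EL) exy).
  - move=> x y; rewrite !in_setU.
    case: (boolP (x \in Cp v)) => Cx;
      case: (boolP (y \in Cp v)) => Cy; rewrite ?orbT ?orbF.
    + by move=> _ _; apply: injg.
    + by move=> _ Wy /eqP; rewrite (negPf (gW _ _ Cx Wy)).
    + by move=> Wx _ /eqP; rewrite eq_sym (negPf (gW _ _ Cy Wx)).
    + exact: injf.
  - move=> x; rewrite !in_setU; case: (boolP (x \in Cp v)) => [Cx _|_]; rewrite ?orbF.
      move: (Cx); rewrite inE => /EL_lev ->; exact/(subsetP sUA)/gU'.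
    exact: fA.
  - move=> x y; rewrite !in_setU.
    case: (boolP (x \in Cp v)) => Cx;
      case: (boolP (y \in Cp v)) => Cy; rewrite ?orbT ?orbF.
    + by move=> _ _; apply: homg.
    + by move=> _ Wy axy; apply: (inW y x) => //; apply: gU'.
    + by move=> Wx _ axy; apply: (outW x y) => //; apply: gU'.
    + exact: homf.
have star0 : 0 < unv_star F.
  have := unv_star_geq (set0 : {set F}); rewrite setC0 cardsT.
  have : 0 < #|F| by apply/card_gt0P; exists v0.
  by lia.
have /card_gt0P[a0 _] : 0 < #|A (lev v0)| := leq_trans star0 (bigA _).
have step (W : {set F}) f : good W f -> W != setT ->
    exists v f', v \notin W /\ good (W :|: Cp v) f'.
  move=> goodW nW; have [cW clW _ fA _] := goodW.
  have [W0|/set0Pn[u0 Wu0]] := eqVneq W set0.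
    exists v0; have [||||||f' gf'] := @extend W f v0 (A (lev v0)) goodW.
    - by rewrite W0 inE.
    - by rewrite W0 set0U; apply: EC.
    - exact: subxx.
    - exact: bigA.
    - by move=> x y; rewrite W0 inE.
    - by move=> x y; rewrite W0 inE.
    by exists f'; rewrite W0 inE -{1}W0.
  have [u [v [Wu vW Euv]]] : exists u v, [/\ u \in W, v \notin W & E u v].
    apply: contrapT => nex; case/negP: nW; apply/eqP/setP => w; rewrite inE.
    have /connectP[p up ->] := conE u0 w.
    elim: p u0 Wu0 up => //= z p IHp x Wx /andP[Exz]; apply: IHp.
    by case: (boolP (z \in W)) => // zW; case: nex; exists x, z.
  have dWC : [disjoint W & Cp v].
    rewrite disjoint_sym; apply/pred0P => x /=; apply/negP => /andP[+ Wx].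
    rewrite inE symEL => /connectP[p xp ev]; case/negP: vW; rewrite ev.
    by elim: p x Wx xp {ev} => //= z p IHp x Wx /andP[/(clW _ _ Wx) Wz]; apply: IHp.
  have Cv : v \in Cp v by rewrite inE connect0.
  have one x y : x \in W -> y \in Cp v -> E x y -> x = u.
    by move=> Wx Cy Exy; have [] := tree_one_edge treeE cW (@EC v) dWC Wx Wu Cy Cv Exy Euv.
  have cWC := connected_in_setU symE cW (@EC v) Wu Cv Euv.
  have lev_uv : lev u != lev v.
    by apply: contraNneq vW => euv; apply: (clW u) => //; rewrite /= Euv euv eqxx.
  have arcE x y : arc x y -> E x y by case: (oriE x y).
  have arcE' x y : arc x y -> E y x by rewrite symE; apply: arcE.
  (* Such an arc would be the edge at [u] descending a level, against [levF]. *)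
  have back x y : x \in W -> y \in Cp v -> lev u < lev v -> arc y x -> False.
    move=> Wx Cy ltuv ayx; have xu := one _ _ Wx Cy (arcE' _ _ ayx).
    move: Cy (levF _ _ ayx); rewrite xu inE => /EL_lev ->.
    by rewrite leqNgt ltuv.
  have back' x y : x \in W -> y \in Cp v -> lev v < lev u -> arc x y -> False.
    move=> Wx Cy ltuv axy; have xu := one _ _ Wx Cy (arcE _ _ axy).
    move: Cy (levF _ _ axy); rewrite xu inE => /EL_lev ->.
    by rewrite leqNgt ltuv.
  exists v; case: (ltngtP (lev u) (lev v)) => [ltuv|ltvu|/val_inj euv].
  - have [||||f' gf'] := @extend W f v (outN (A (lev v)) (f u)) goodW vW cWC.
    + by apply/subsetP => w; rewrite inE => /andP[].
    + by apply: (outA (lev u)) => //; apply: fA.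
    + move=> x y Wx Cy axy w; rewrite inE => /andP[_].
      by rewrite (one _ _ Wx Cy (arcE _ _ axy)).
    + by move=> x y Wx Cy ayx; case: (back _ _ Wx Cy ltuv ayx).
    by exists f'.
  - have [||||f' gf'] := @extend W f v (inN (A (lev v)) (f u)) goodW vW cWC.
    + by apply/subsetP => w; rewrite inE => /andP[].
    + by apply: (inA (lev u)) => //; apply: fA.
    + by move=> x y Wx Cy axy; case: (back' _ _ Wx Cy ltvu axy).
    + move=> x y Wx Cy ayx w; rewrite inE => /andP[_].
      by rewrite (one _ _ Wx Cy (arcE' _ _ ayx)).
    by exists f'.
  - by rewrite euv eqxx in lev_uv.
have main n (W : {set F}) f : #|~: W| <= n -> good W f -> exists f', good setT f'.
  elim: n W f => [|n IHn] W f cW gW.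
    exists f; move: cW; rewrite leqn0 cards_eq0 => /eqP/(congr1 (@setC F)).
    by rewrite setCK setC0 => <-.
  have [WT|nW] := eqVneq W setT; first by exists f; rewrite -WT.
  have [v [f' [vW gf']]] := step W f gW nW.
  apply: IHn gf'; rewrite -ltnS; apply: leq_trans cW; apply/proper_card/properP; split.
    by rewrite setCS subsetUl.
  by exists v; rewrite !inE // connect0 orbT.
have [||f [_ _ injf fA homf]] := main #|F| set0 (fun=> a0).
- exact: max_card.
- by split=> x; rewrite ?inE // => y; rewrite inE.
exists f; split=> [x y|x|x y]; [exact: injf|exact: fA|exact: homf].
Qed.

(** * The transitive skeleton of the tournament *)

Lemma tournament_asym (T : digraph) (x y : T) :
  tournament T -> arc x y -> arc y x -> False.
Proof.
move=> [irrT totT]; have [->|xy] := eqVneq x y; first by rewrite irrT.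
by move=> axy ayx; have := totT x y xy; rewrite axy ayx.
Qed.

(** The interleaved order is [g 0], [t 0], [g 1], ..., [t (k-1)], [g k]: the odd positions are
    common to all tuples, the even ones vary over [Q]. *)
Lemma transitive_skeleton (T : digraph) (k m : nat) :
    tournament T -> 0 < k -> 0 < m -> #|T| = 3 ^ 'C(2 * k + 2, 2) * m ->
  exists (t : 'I_k -> T) (Q : {set {ffun 'I_k.+1 -> T}}),
    [/\ Q != set0, forall i j : 'I_k, i < j -> arc (t i) (t j),
      forall g : {ffun 'I_k.+1 -> T}, g \in Q ->
      [/\ forall i j : 'I_k.+1, i < j -> arc (g i) (g j),
        forall (i : 'I_k.+1) (j : 'I_k), i <= j -> arc (g i) (t j) &
        forall (i : 'I_k.+1) (j : 'I_k), j < i -> arc (t j) (g i)]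
    & forall (g : {ffun 'I_k.+1 -> T}) i j, g \in Q -> i != j ->
      m <= #|[set (g' : {ffun 'I_k.+1 -> T}) j | g' in [set g' in Q | g' i == g i]]|].
Proof.
move=> tT k0 m0 cT.
have /card_gt0P[x0 _] : 0 < #|T| by rewrite cT muln_gt0 expn_gt0.
pose r := (2 * k).+1; pose M := 3 ^ 'C(r, 2) * m; pose N := #|T|.
have NE : N = 3 ^ r * M.
  by rewrite /N cT /M mulnA -expnD addn2 binS bin1 addnC.
have binr : 'C(r, 2) = r * k.
  by rewrite bin2 /= mulnCA mul2n half_double.
have cP : m * N ^ k * N ^ k <= #|transitive_tuples r [set: T]|.
  apply: leq_trans (many_transitive_tuples (M := M) tT _); last by rewrite cardsT -NE.
  (* As [N = 3 ^ r * M] and ['C(r, 2) = r * k], the target equals the bound [3 ^ 'C(r, 2) * M ^ r]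
     exactly. *)
  have -> : m * N ^ k * N ^ k = 3 ^ (r * k) * (3 ^ (r * k) * m * M ^ (2 * k)).
    rewrite -mulnA -expnD addnn -mul2n NE expnMn -expnM mulnCA mul2n -addnn mulnDr.
    by rewrite expnD !mulnA.
  by rewrite [M ^ r]expnS /M binr.
pose odds (s : r.-tuple T) := [ffun i : 'I_k => nth x0 s (2 * i).+1].
pose evens (s : r.-tuple T) := [ffun i : 'I_k.+1 => nth x0 s (2 * i)].
(* Pigeonhole over the [N ^ k] possible odd parts. *)
have [t lt_t] : exists t,
    m.-1 * N ^ k < #|[set s in transitive_tuples r [set: T] | odds s == t]|.
  apply/existsP; apply: contraLR cP; rewrite negb_exists -ltnNge => /forallP small.
  rewrite -sum1_card (partition_big odds predT) //=.
  apply: (@leq_ltn_trans (\sum_(t : {ffun 'I_k -> T}) m.-1 * N ^ k)).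
    by apply: leq_sum => t _; rewrite sum1dep_card leqNgt; apply: small.
  rewrite sum_nat_const card_ffun card_ord -/N mulnC.
  have N0 : 0 < N by apply/card_gt0P; exists x0.
  by rewrite !ltn_pmul2r ?expn_gt0 ?N0 // prednK.
set P := [set s in _ | _] in lt_t.
have PE s i j : s \in P -> i < j -> j < r -> arc (nth x0 s i) (nth x0 s j).
  rewrite !inE => /andP[/andP[/(pairwiseP x0) + _] _] ij jr.
  by apply; rewrite ?inE ?size_tuple // (ltn_trans ij).
have tE s (i : 'I_k) : s \in P -> t i = nth x0 s (2 * i).+1.
  by rewrite inE => /andP[_ /eqP <-]; rewrite ffunE.
(* Members of [P] share their odd entries, so the even ones determine them. *)
have evens_inj : {in P &, injective evens}.
  move=> s s' Ps Ps' ess'; apply: val_inj; apply: (@eq_from_nth _ x0).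
    by rewrite !size_tuple.
  rewrite size_tuple => i ir; rewrite -(odd_double_half i) -mul2n.
  case: (odd i) (odd_double_half i) => [ei|ei]; rewrite ?add1n ?add0n.
    have ik : i./2 < k by rewrite /r in ir; lia.
    by rewrite -(tE s (Ordinal ik)) // -(tE s' (Ordinal ik)).
  have ik : i./2 < k.+1 by rewrite /r in ir; lia.
  by move/ffunP/(_ (Ordinal ik)): ess'; rewrite !ffunE.
pose Q := evens @: P.
have QE (g : {ffun 'I_k.+1 -> T}) : g \in Q ->
      [/\ forall i j : 'I_k.+1, i < j -> arc (g i) (g j),
    forall (i : 'I_k.+1) (j : 'I_k), i <= j -> arc (g i) (t j) &
    forall (i : 'I_k.+1) (j : 'I_k), j < i -> arc (t j) (g i)].
  move=> /imsetP[s Ps ->]; split=> i j ij; rewrite ?(tE s) // !ffunE;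
    apply: PE => //; rewrite /r; move: (ltn_ord i) (ltn_ord j); lia.
(* For [i < j], a vertex at position [i] has an arc to [t i] and one at position [j] an arc from
   [t i], whichever tuples they come from. *)
have disjQ : {in Q &, forall (g g' : {ffun 'I_k.+1 -> T}) i j, g i = g' j -> i = j}.
  have lt_neq (g g' : {ffun 'I_k.+1 -> T}) (i j : 'I_k.+1) :
      g \in Q -> g' \in Q -> i < j -> g i <> g' j.
    move=> /QE[_ gt _] /QE[_ _ tg'] ij eij.
    have ik : i < k by move: (ltn_ord j); lia.
    have := gt i (Ordinal ik) (leqnn _); rewrite eij => a.
    exact: (tournament_asym tT a (tg' _ (Ordinal ik) _)).
  move=> g g' Qg Qg' i j e; apply: val_inj; case: (ltngtP i j) => // ij.
    by case: (lt_neq _ _ _ _ Qg Qg' ij).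
  by case: (lt_neq _ _ _ _ Qg' Qg ij).
have [||Q' [sQ' nQ'] degQ'] := @dense_subfamily _ _ m Q disjQ.
- by rewrite card_ord.
- by rewrite card_ord subn1 card_in_imset.
exists t, Q'; split=> //.
- move=> i j ij; have /card_gt0P[s Ps] : 0 < #|P| by apply: leq_trans lt_t.
  by rewrite !(tE s) //; apply: PE => //; rewrite /r; move: (ltn_ord j); lia.
- by move=> g /(subsetP sQ'); apply: QE.
Qed.

(** * Topological order and final embedding *)

(** The number of ancestors grows strictly along arcs; scaling it by [#|D|] leaves room for the
    enumeration index to break ties. *)
Lemma topological_rank (D : digraph) : acyclic D ->
  exists rho : D -> nat, injective rho /\ {homo rho : x y / arc x y >-> x < y}.
Proof.
move=> aD; pose anc x := [set z | connect (@arc D) z x].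
exists (fun x => #|anc x| * #|D| + enum_rank x); split=> [x y e|x y axy].
  have := congr1 (modn^~ #|D|) e; rewrite !modnMDl !modn_small //.
  by move=> /val_inj/enum_rank_inj.
have lt_anc : #|anc x| < #|anc y|.
  apply/proper_card/properP; split.
    apply/subsetP => z; rewrite !inE => /connect_trans; apply; exact: connect1.
  exists y; rewrite !inE ?connect0 //; apply/negP => /(acyclic_back aD).
  by rewrite axy.
apply: (@leq_trans (#|anc x|.+1 * #|D|)).
  by rewrite mulSn addnC ltn_add2r.
by apply: leq_trans (leq_addr _ _); rewrite leq_mul2r lt_anc orbT.
Qed.

Theorem theorem24 (k n : nat) (F D : dag) (hk : 1 <= k) (hn : 2 <= n)
    (hF : oriented_tree F) (hFn : #|F| = n) (hD : k_extension k F D) :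
  unv D <= 3 ^ 'C(2 * k + 2, 2) * unv_star F.
Proof.
have m0 : 0 < unv_star F.
  have := unv_star_geq (set0 : {set F}); rewrite setC0 cardsT; lia.
apply: unv_leq => T tT cT.
have [t [Q [nQ tt QE degQ]]] := transitive_skeleton tT hk m0 cT.
have [S [cS [phi [[psi phiK psiK] monophi]]]] := hD.
have [rho [injrho homorho]] := topological_rank (@dag_acyclic D).
(* On [S] this is the index of the image among the [t i]; elsewhere it is the level. *)
pose L x := #|[set s in S | rho s < rho x]|.
have leL x y : rho x <= rho y -> L x <= L y.
  move=> xy; apply/subset_leq_card/subsetP => s; rewrite !inE => /andP[->].
  by move=> /leq_trans; apply.
have ltL x y : x \in S -> rho x < rho y -> L x < L y.
  move=> Sx xy; apply/proper_card/properP; split.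
    by apply/subsetP => s; rewrite !inE => /andP[-> /= /ltn_trans]; apply.
  by exists x; rewrite !inE Sx // ltnn.
have LS x : x \in S -> L x < k.
  move=> Sx; rewrite -cS; apply/proper_card/properP; split.
    by apply/subsetP => s; rewrite inE => /andP[].
  by exists x; rewrite // inE ltnn andbF.
have Lk x : L x < k.+1.
  by rewrite ltnS -cS; apply/subset_leq_card/subsetP => s; rewrite inE => /andP[].
pose lev (v : F) := Ordinal (Lk (val (psi v))).
pose A (i : 'I_k.+1) := [set (g : {ffun 'I_k.+1 -> T}) i | g in Q].
have AE i x : x \in A i -> exists2 g, g \in Q & x = g i by move=> /imsetP.
have degA (i j : 'I_k.+1) (X : {set T}) (g : {ffun 'I_k.+1 -> T}) :
    g \in Q -> i != j ->
    (forall g' : {ffun 'I_k.+1 -> T}, g' \in Q -> g' i = g i -> g' j \in X) ->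
    unv_star F <= #|X|.
  move=> Qg ij inX; apply: leq_trans (degQ g i j Qg ij) _.
  apply/subset_leq_card/subsetP => _ /imsetP[g' + ->].
  by rewrite inE => /andP[Qg' /eqP]; apply: inX.
have [f [injf fA homf]] : exists f : F -> T,
    [/\ injective f, forall v, f v \in A (lev v) & {homo f : x y / arc x y}].
  apply: (embed_leveled_tree hF tT).
  - move=> u v auv; apply: leL; apply: ltnW; apply: homorho.
    have : arc (psi u) (psi v) by rewrite -monophi !psiK.
    by case/andP.
  - move=> i; have [g Qg] := set0Pn _ nQ.
    (* Since [k >= 1] there is a second index, and [degQ] from it bounds [#|A i|]. *)
    have [j ij] : exists j, j != i.
      exists (if i == ord0 then ord_max else ord0).
      by case: (eqVneq i ord0) => [->|ni]; rewrite ?[ord0 == i]eq_sym // -val_eqE /= -lt0n.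
    by apply: (degA j i _ g) => // g' Qg' _; apply/imsetP; exists g'.
  - move=> i j x ij /AE[g Qg ->]; apply: (degA i j _ g) => //.
      by rewrite -val_eqE neq_ltn ij.
    move=> g' Qg' <-; rewrite inE; have [-> // _ _] := QE _ Qg'.
    by rewrite andbT; apply/imsetP; exists g'.
  - move=> i j x ij /AE[g Qg ->]; apply: (degA i j _ g) => //.
      by rewrite -val_eqE neq_ltn ij orbT.
    move=> g' Qg' <-; rewrite inE; have [-> // _ _] := QE _ Qg'.
    by rewrite andbT; apply/imsetP; exists g'.
(* The default of [insubd] is never reached, as [L x < k] on [S]. *)
pose h x : T := if insub x is Some y then f (phi y) else t (insubd (Ordinal hk) (L x)).
have hS x (Sx : x \in S) : h x = t (Ordinal (LS x Sx)).
  rewrite /h insubN ?inE ?Sx //; congr t; apply: val_inj.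
  by rewrite val_insubd LS.
have hF' x (Sx : x \notin S) : exists v, [/\ val (psi v) = x, h x = f v & phi (psi v) = v].
  have Cx : x \in ~: S by rewrite inE.
  exists (phi (Sub x Cx)); rewrite phiK /h insubT.
  by split.
have hA x (Sx : x \notin S) : exists2 g, g \in Q & h x = g (Ordinal (Lk x)).
  have [v [vx -> _]] := hF' x Sx; have [g Qg ->] := AE _ _ (fA v).
  by exists g => //; congr (g _); apply: val_inj; rewrite /= vx.
(* Along an arc [L] grows strictly if the tail is in [S] and weakly otherwise, matching [j < i] and
   [i <= j] in [QE]. *)
have homh : {homo h : x y / arc x y}.
  move=> x y axy; have lt_xy := homorho _ _ axy.
  have [Sx|Sx] := boolP (x \in S); have [Sy|Sy] := boolP (y \in S).
  - by rewrite !hS; apply: tt; apply: ltL.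
  - have [g Qg ->] := hA y Sy; rewrite hS; have [_ _ tg] := QE _ Qg.
    by apply: tg; apply: ltL.
  - have [g Qg ->] := hA x Sx; rewrite hS; have [_ gt _] := QE _ Qg.
    by apply: gt; apply/leL/ltnW.
  - have [u [ux -> pu]] := hF' x Sx; have [v [vy -> pv]] := hF' y Sy.
    apply: homf; rewrite -pu -pv monophi /= ux vy axy inE //.
have [irrT _] := tT.
(* The two images are joined by an arc, whichever way [L x] and [L y] compare. *)
have mixed x y : x \in S -> y \notin S -> h x <> h y.
  move=> Sx Sy; have [g Qg ->] := hA y Sy; rewrite hS => e.
  have [_ gt tg] := QE _ Qg; case: (ltnP (L x) (L y)) => xy.
    by have := tg (Ordinal (Lk y)) (Ordinal (LS x Sx)) xy; rewrite e irrT.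
  by have := gt (Ordinal (Lk y)) (Ordinal (LS x Sx)) xy; rewrite e irrT.
exists h; split=> // x y exy.
have [Sx|Sx] := boolP (x \in S); have [Sy|Sy] := boolP (y \in S).
- apply: injrho; move: exy; rewrite !hS => e; case: (ltngtP (rho x) (rho y)) => // xy.
    by have := tt (Ordinal (LS x Sx)) (Ordinal (LS y Sy)) (ltL _ _ Sx xy); rewrite e irrT.
  by have := tt (Ordinal (LS y Sy)) (Ordinal (LS x Sx)) (ltL _ _ Sy xy); rewrite e irrT.
- by case: (mixed x y Sx Sy).
- by case: (mixed y x Sy Sx).
- move: exy; have [u [<- -> <-]] := hF' x Sx; have [v [<- -> <-]] := hF' y Sy.
  by move=> /injf ->.
Qed.
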